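(* Let $N \geq 1$ be an integer. Then (i) $\displaystyle \frac{\sigma(N)}{N} = 3 \sum_{n=1}^{\infty} \frac{1}{n^2} \sum_{d \mid n} \binom{2d}{d}^{-1} c_{n/d}(N)$, (ii) $\displaystyle \frac{\sigma_2(N)}{N^2} = \frac{5}{2} \sum_{n=1}^{\infty} \frac{1}{n^3} \left[ \sum_{d \mid n} (-1)^{d-1} \binom{2d}{d}^{-1} c_{n/d}(N) \right]$, (iii) $\displaystyle \frac{\sigma_3(N)}{N^3} = \frac{36}{17} \sum_{n=1}^{\infty} \frac{1}{n^4} \sum_{d \mid n} \binom{2d}{d}^{-1} c_{n/d}(N)$.
   Context: For an integer $N \geq 1$ and $s \in \mathbb{C}$, $\sigma_s(N) = \sum_{d \mid N} d^s$ (sum over positive divisors), and $\sigma(N) = \sigma_1(N)$. For integers $k, N \geq 1$, $c_k(N)$ is the Ramanujan sum $c_k(N) = \sum_{1 \le u \le k,\ \gcd(u,k)=1} e^{-i 2\pi u N/k}$ (an integer). The binomial coefficient is $\binom{n}{k} = \frac{n!}{k!(n-k)!}$. Inner sums run over positive divisors $d$ of $n$. *)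

(* Defs.v *)
From mathcomp Require Import all_boot all_order all_algebra.
From mathcomp Require Import all_classical all_reals all_analysis.
From mathcomp Require Import complex.

Set Implicit Arguments.
Unset Strict Implicit.
Unset Printing Implicit Defensive.

Import Order.TTheory GRing.Theory Num.Theory.
Import numFieldNormedType.Exports.

Local Open Scope ring_scope.
Local Open Scope complex_scope.

(* Only natural exponents s are needed. *)
Definition sigma (s N : nat) : nat := (\sum_(d <- divisors N) d ^ s)%N.

Definition cexp (R : realType) (z : R[i]) : R[i] :=
  (expR (complex.Re z))%:C * (cos (complex.Im z) +i* sin (complex.Im z)).

Definition ramanujan_sum (R : realType) (k N : nat) : R[i] :=
  \sum_(1 <= u < k.+1 | coprime u k)
    cexp (- 'i%C * 2%:R * pi%:C%C * u%:R * N%:R / k%:R).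

(* The modulus topology on the complex numbers is carried by R[i]^o, not by
   R[i] itself. *)
Definition series_cvg (R : realType) (a : nat -> R[i]) : Prop :=
  cvgn (fun m : nat => \sum_(1 <= n < m) (a n : R[i]^o)).

(* A limit of partial sums: meaningful only together with series_cvg a. *)
Definition series_sum (R : realType) (a : nat -> R[i]) : R[i] :=
  \big[+%R/0]_(1 <= n <oo) (a n : R[i]^o).

(* Main.v *)
Require Import Defs.
From mathcomp Require Import all_boot all_order all_algebra.
From mathcomp Require Import all_classical all_reals all_analysis.
From mathcomp Require Import complex.
From mathcomp Require Import ring lra zify.
Import Order.TTheory GRing.Theory Num.Theory.
Import numFieldNormedType.Exports.
Local Open Scope ring_scope.

(** Since [\sum_(d | k) c_d(N)] is [k] if [k] divides [N] and [0] otherwise, the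
   Dirichlet series of the Ramanujan sums satisfies
   [zeta s * \sum_k c_k(N) / k^s = sigma_(s-1)(N) / N^(s-1)]; Moebius inversion
   bounds [c_k(N)] independently of [k], so that all products of series converge
   absolutely.  The theorem thus reduces to
     [\sum 1 / (n^2 C(2n,n)) = zeta 2 / 3],
     [\sum (-1)^(n-1) / (n^3 C(2n,n)) = 2/5 zeta 3],
     [\sum 1 / (n^4 C(2n,n)) = 17/36 zeta 4].
   With [S_2 = \sum_n (\sum_(j < n) 1/j^2) / (n^2 C(2n,n))], the first two, and
   [7/8 zeta 4 = 2 \sum 1 / (n^4 C(2n,n)) - 3/2 S_2], come from Apery's telescoping
   double sums.  For the third one, squaring the generating function
   [\sum t^n / (n^2 C(2n,n))] (which is [2 arcsin(sqrt t / 2)^2]) gives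
   [S_2 = zeta(2)^2 / 54], and Euler's relation [zeta(2)^2 = 5/2 zeta 4] concludes. *)

(** * Apery's telescoping sums *)

Section AperySums.
Context {R : realFieldType}.
Implicit Types n k m : nat.

(** For [1 <= k <= n] this is [1 / (k^2 C(n,k) C(n+k,k))], up to a factor in [k] the double sequence
    of Apery's work on zeta(3). *)
Definition apery n k : R := (k.-1`! ^ 2 * (n - k)`!)%:R / (n + k)`!%:R.

(** For [k < n] this is [k!^2] over [n^2 (n^2 - 1^2) ... (n^2 - k^2)]. With alternating signs it is
    an antidifference in [k]. *)
Definition apery_primitive n k : R :=
  (k`! ^ 2 * (n - k).-1`!)%:R / (n * (n + k)`!)%:R.

Definition central_term n : R := ((n ^ 2)%:R * 'C(2 * n, n)%:R)^-1.

Definition harmonic2 n : R := \sum_(1 <= j < n) (j%:R ^+ 2)^-1.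

Lemma fact_neq0 n : n`!%:R != 0 :> R.
Proof. by rewrite pnatr_eq0 -lt0n fact_gt0. Qed.

Lemma apery_diag n : (0 < n)%N -> apery n n = central_term n.
Proof.
case: n => // n _; rewrite /apery /central_term subnn fact0 muln1 /= addnn -mul2n.
have : (n.+1 <= 2 * n.+1)%N by lia.
move=> /bin_fact.
rewrite mul2n -addnn addnK => /(congr1 (fun m => m%:R : R)).
rewrite factS !natrM => <-.
have := fact_neq0 n; have : 'C(n.+1 + n.+1, n.+1)%:R != 0 :> R.
  by rewrite pnatr_eq0 -lt0n bin_gt0 leq_addr.
have : n.+1%:R != 0 :> R by rewrite pnatr_eq0.
by move=> h1 h2 h3; field; rewrite nat1r h1 h2 h3.
Qed.

(** With [e = (k-1)!^2 (n-k-1)! / (n+k)!] one has [apery n k = (n-k) e], [apery n.-1 k = (n+k) e]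
    and [apery_primitive n k = k^2 e / n], while the two consecutive primitives add up to [n e].
    Writing [n] as [k + m.+1] keeps the truncated subtractions exact. *)
Lemma apery_steps k m (n := (k + m.+1)%N) : (0 < k)%N ->
  [/\ apery n k + apery n.-1 k =
        2%:R * (apery_primitive n k.-1 + apery_primitive n k),
      n%:R ^+ 2 * apery_primitive n k =
        k%:R ^+ 2 * (apery_primitive n k.-1 + apery_primitive n k)
    & apery n.-1 k - apery n k =
        2%:R * k%:R / n%:R * (apery_primitive n k.-1 + apery_primitive n k)].
Proof.
rewrite /n; case: k {n} => // k _; rewrite /apery /apery_primitive /=.
have -> : (k.+1 + m.+1 - k.+1)%N = m.+1 by lia.
have -> : ((k.+1 + m.+1).-1 - k.+1)%N = m by lia.
have -> : (k.+1 + m.+1 - k)%N = m.+2 by lia.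
have -> : ((k.+1 + m.+1) + k.+1)%N = (k + k + m + 2).+1 by lia.
have -> : ((k.+1 + m.+1).-1 + k.+1)%N = (k + k + m + 2)%N by lia.
have -> : (k.+1 + m.+1 + k)%N = (k + k + m + 2)%N by lia.
rewrite !factS /= !natrM.
have := fact_neq0 (k + k + m + 2); have := fact_neq0 k; have := fact_neq0 m.
set x := (k`!)%:R; set y := (m`!)%:R; set z := (_`!)%:R => y0 x0 z0.
have h1 : (k + k + m + 2).+1%:R != 0 :> R by rewrite pnatr_eq0.
have h2 : (k.+1 + m.+1)%:R != 0 :> R by rewrite pnatr_eq0.
have h3 : m.+1%:R != 0 :> R by rewrite pnatr_eq0.
have h4 : k.+1%:R != 0 :> R by rewrite pnatr_eq0.
have h1' : 1 + (k%:R + k%:R + m%:R + 2) != 0 :> R by move: h1; rewrite -natr1 !natrD addrC.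
have h2' : 1 + k%:R + (1 + m%:R) != 0 :> R by move: h2; rewrite !natrD -!natr1 ![_ + 1]addrC.
by split; field; rewrite ?z0 ?h1' ?h2'.
Qed.

Lemma apery_primitive0 n : (0 < n)%N -> apery_primitive n 0 = (n%:R ^+ 2)^-1.
Proof.
case: n => // n _; rewrite /apery_primitive fact0 subn0 addn0 factS /= !natrM.
have := fact_neq0 n; have : n.+1%:R != 0 :> R by rewrite pnatr_eq0.
by move=> h h1; field; rewrite nat1r h.
Qed.

Lemma apery_primitive_last n : (0 < n)%N ->
  apery_primitive n n.-1 = 2%:R * central_term n.
Proof.
case: n => // n _; rewrite -apery_diag // /apery_primitive /apery /= subSnn subnn /=.
rewrite fact0 muln1 !addSn !addnS !factS !natrM.
have := fact_neq0 (n + n); have : n.+1%:R != 0 :> R by rewrite pnatr_eq0.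
have : (n + n).+1%:R != 0 :> R by rewrite pnatr_eq0.
set z := (_`!)%:R; rewrite -[(n + n).+2%:R]natr1 -(natr1 (n + n)) -(natr1 n) natrD => h1 h2 h3.
by field; rewrite h1 h2 h3 -addrA -(natrD _ 1 1) -!natrD pnatr_eq0; lia.
Qed.

Lemma harmonic2S n : (0 < n)%N -> harmonic2 n.+1 = harmonic2 n + (n%:R ^+ 2)^-1.
Proof. by move=> n0; rewrite /harmonic2 big_nat_recr. Qed.

Lemma harmonic2_ge0 n : 0 <= harmonic2 n.
Proof. by apply: sumr_ge0 => j _; rewrite invr_ge0 exprn_ge0. Qed.

(** From [1/(n+1)^2 <= 1/n - 1/(n+1)]; the subtracted inverse strengthens the bound by [2] so that
    the induction goes through. *)
Lemma harmonic2_le n : harmonic2 n.+2 <= 2%:R - n.+1%:R^-1.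
Proof.
elim: n => [|n IH]; first by rewrite /harmonic2 big_nat1 expr1n !invr1; lra.
rewrite harmonic2S //; apply: le_trans (lerD IH (lexx _)) _.
have n0 : 0 < n.+1%:R :> R by rewrite ltr0n.
rewrite -(natr1 n.+1); set x := n.+1%:R in n0 *.
rewrite -subr_ge0.
suff -> : 2%:R - (x + 1)^-1 - (2%:R - x^-1 + ((x + 1) ^+ 2)^-1) = (x * (x + 1) ^+ 2)^-1.
  by rewrite invr_ge0 mulr_ge0 ?exprn_ge0 //; lra.
by field; rewrite !lt0r_neq0 //; lra.
Qed.

Lemma harmonic2_le2 n : harmonic2 n <= 2%:R.
Proof.
case: n => [|[|n]]; try by rewrite /harmonic2 big_geq.
by apply: le_trans (harmonic2_le n) _; rewrite gerBl invr_ge0.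
Qed.

(** * Sums of the telescoping kernel *)

Let kern n k : R := apery_primitive n k.-1 + apery_primitive n k.

(** The alternating signs make consecutive primitives cancel, leaving those at [0] and at [n.-1]. *)
Lemma sum_kern n : (0 < n)%N ->
  \sum_(1 <= k < n) (-1) ^+ k.-1 * kern n k =
  (n%:R ^+ 2)^-1 - (-1) ^+ n.-1 * (2%:R * central_term n).
Proof.
move=> n0; rewrite -apery_primitive0 // -apery_primitive_last //.
have tele m : \sum_(1 <= k < m.+1) (-1) ^+ k.-1 * kern n k =
  apery_primitive n 0 - (-1) ^+ m * apery_primitive n m.
  elim: m => [|m IH]; first by rewrite big_geq // mul1r subrr.
  by rewrite big_nat_recr //= IH /kern /= exprS; ring.
by case: n n0 tele => // n _ ->.
Qed.

(** Summation by parts: [harmonic2] grows by [1/k^2], and [apery_primitive n k / k^2] is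
    [kern n k / n^2], so what remains is the telescoping sum of [kern] again. *)
Lemma sum_kern_harmonic2 n : (0 < n)%N ->
  \sum_(1 <= k < n) (-1) ^+ k.-1 * harmonic2 k * kern n k =
  (-1) ^+ n.-1 * (2%:R * central_term n) * ((n%:R ^+ 2)^-1 - harmonic2 n)
  - (n%:R ^+ 4)^-1.
Proof.
move=> n0; rewrite -apery_primitive_last //.
have tele m : (m < n)%N -> \sum_(1 <= k < m.+1) (-1) ^+ k.-1 * harmonic2 k * kern n k =
  (-1) ^+ m * apery_primitive n m * ((n%:R ^+ 2)^-1 - harmonic2 m.+1) - (n%:R ^+ 4)^-1.
  elim: m => [|m IH] mn.
    rewrite big_geq // /harmonic2 big_geq // apery_primitive0 // subr0 mul1r.
    by rewrite -invfM -exprD subrr.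
  rewrite big_nat_recr //= IH; last by lia.
  rewrite (@harmonic2S m.+1) //.
  have [_ + _] := @apery_steps m.+1 (n - m.+2) isT.
  have -> : (m.+1 + (n - m.+2).+1)%N = n by lia.
  rewrite -/(kern n m.+1) => e.
  have n1 : n%:R != 0 :> R by rewrite pnatr_eq0; lia.
  have m1 : m.+1%:R != 0 :> R by rewrite pnatr_eq0.
  have -> : apery_primitive n m = kern n m.+1 - apery_primitive n m.+1.
    by rewrite /kern addrK.
  have -> : apery_primitive n m.+1 = m.+1%:R ^+ 2 / n%:R ^+ 2 * kern n m.+1.
    by apply: (mulfI (x := n%:R ^+ 2)); rewrite ?expf_neq0 // e; field.
  by rewrite [(-1) ^+ m.+1]exprS; field; rewrite n1 nat1r.
by case: n n0 tele => // n _ ->.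
Qed.

(** For fixed [k], [2 kern n k = apery n k + apery n.-1 k] telescopes under the sign [(-1)^(n-1)]
    for [n] from [k+1] to [M]. The ends are [apery M k] and the diagonal [apery k k], which is the
    central binomial term. *)
Lemma sum_alternating_kern (h : nat -> R) M :
  \sum_(1 <= n < M.+1) (-1) ^+ n.-1 *
    \sum_(1 <= k < n) (-1) ^+ k.-1 * h k * (2%:R * kern n k) =
  (-1) ^+ M.-1 * \sum_(1 <= k < M.+1) (-1) ^+ k.-1 * h k * apery M k -
  \sum_(1 <= k < M.+1) h k * central_term k.
Proof.
elim: M => [|M IH]; first by rewrite !big_geq // mulr0 subr0.
rewrite big_nat_recr //= IH ![\sum_(1 <= k < M.+2) _]big_nat_recr //=.
rewrite apery_diag // [X in _ + _ * X](eq_big_nat _ _ (F2 := fun k =>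
  (-1) ^+ k.-1 * h k * apery M.+1 k + (-1) ^+ k.-1 * h k * apery M k)).
  (* The case [M = 0] stands apart: there [M.-1] truncates, so the sign does not flip from [M] to
     [M.+1], but the sums are empty. *)
  rewrite big_split /=; case: M IH => [_|M _].
    by rewrite !big_geq // !expr0; ring.
  rewrite [M.+1.-1]/= exprS; set s := (-1) ^+ M.
  have ss : s * s = 1 by rewrite -expr2 sqrr_sign.
  set a := \sum_(_ <= _ < _) _; set b := \sum_(_ <= _ < _) _; set c := \sum_(_ <= _ < _) _.
  by ring: (congr1 (fun z => z * (h M.+2 * central_term M.+2)) ss).
move=> k /andP[k0 kM]; rewrite -mulrDr.
have [+ _ _] := @apery_steps k (M - k) k0.
have -> : (k + (M - k).+1)%N = M.+1 by lia.
by rewrite -/(kern _ _) /= => ->.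
Qed.

(** For fixed [k], [kern n k / n] is [(apery n.-1 k - apery n k) / (2k)], which telescopes in [n]
    from [k+1] to [M]. *)
Lemma sum_kern_div M :
  \sum_(1 <= n < M.+1) n%:R^-1 * \sum_(1 <= k < n) (-1) ^+ k.-1 * kern n k =
  \sum_(1 <= k < M.+1) (-1) ^+ k.-1 / (2%:R * k%:R) * (central_term k - apery M k).
Proof.
elim: M => [|M IH]; first by rewrite !big_geq.
rewrite big_nat_recr //= IH [RHS]big_nat_recr //= apery_diag // subrr mulr0 addr0.
rewrite mulr_sumr -big_split /=; apply: eq_big_nat => k /andP[k0 kM].
have [_ _] := @apery_steps k (M - k) k0.
have -> : (k + (M - k).+1)%N = M.+1 by lia.
rewrite -/(kern _ _) /= => e.
have M1 : M.+1%:R != 0 :> R by rewrite pnatr_eq0.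
have k1 : k%:R != 0 :> R by rewrite pnatr_eq0; lia.
have -> : apery M k = apery M.+1 k + 2%:R * k%:R / M.+1%:R * kern M.+1 k.
  by rewrite -e; ring.
by field; rewrite k1 nat1r.
Qed.

(** Weight [1] in [sum_alternating_kern], with inner sums from [sum_kern]: writing [S] for the
    central sum, [2 eta - 4 S = error - S], whence [3/2]. *)
Lemma eta2_partial M :
  \sum_(1 <= n < M.+1) (-1) ^+ n.-1 / n%:R ^+ 2 =
  3%:R / 2%:R * \sum_(1 <= n < M.+1) central_term n +
  2%:R^-1 * (-1) ^+ M.-1 * \sum_(1 <= k < M.+1) (-1) ^+ k.-1 * apery M k.
Proof.
have := sum_alternating_kern (fun=> 1) M.
rewrite (eq_big_nat _ _ (F2 := fun n => 2%:R * ((-1) ^+ n.-1 / n%:R ^+ 2) -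
  4%:R * central_term n)); last first.
  move=> n /andP[n0 _]; under eq_bigr do rewrite mulr1 mulrCA.
  rewrite -mulr_sumr sum_kern //.
  set s := (-1) ^+ _; have ss : s * s = 1 by rewrite -expr2 sqrr_sign.
  rewrite mulrCA mulrBr [s * (s * _)]mulrA ss; ring.
rewrite big_split /= sumrN -!mulr_sumr.
under [X in _ = _ * X - _]eq_bigr do rewrite mulr1.
rewrite mul1r.
by move=> e; lra.
Qed.

(** Equates the evaluations of one double sum by rows ([sum_kern]) and by columns ([sum_kern_div]);
    [5/2] is [2 + 1/2]. *)
Lemma zeta3_partial M :
  \sum_(1 <= n < M.+1) (n%:R ^+ 3)^-1 =
  5%:R / 2%:R * \sum_(1 <= n < M.+1) (-1) ^+ n.-1 * central_term n / n%:R -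
  2%:R^-1 * \sum_(1 <= k < M.+1) (-1) ^+ k.-1 / k%:R * apery M k.
Proof.
have := sum_kern_div M.
rewrite (eq_big_nat _ _ (F2 := fun n => (n%:R ^+ 3)^-1 -
  2%:R * ((-1) ^+ n.-1 * central_term n / n%:R))); last first.
  move=> n /andP[n0 _]; rewrite sum_kern //.
  have n1 : n%:R != 0 :> R by rewrite pnatr_eq0; lia.
  by field.
rewrite [X in _ = X -> _](eq_big_nat _ _ (F2 := fun k =>
  2%:R^-1 * ((-1) ^+ k.-1 * central_term k / k%:R) -
  2%:R^-1 * ((-1) ^+ k.-1 / k%:R * apery M k))); last first.
  move=> k /andP[k0 _].
  have k1 : k%:R != 0 :> R by rewrite pnatr_eq0; lia.
  by field.
rewrite ![\sum_(_ <= _ < _) (_ - _)]big_split /= !sumrN -!mulr_sumr.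
by move=> e; lra.
Qed.

(** Weight [harmonic2] in [sum_alternating_kern], with inner sums from [sum_kern_harmonic2]. *)
Lemma eta4_partial M :
  \sum_(1 <= n < M.+1) (-1) ^+ n.-1 / n%:R ^+ 4 =
  2%:R * \sum_(1 <= n < M.+1) central_term n / n%:R ^+ 2 -
  3%:R / 2%:R * \sum_(1 <= n < M.+1) harmonic2 n * central_term n -
  2%:R^-1 * (-1) ^+ M.-1 *
    \sum_(1 <= k < M.+1) (-1) ^+ k.-1 * harmonic2 k * apery M k.
Proof.
have := sum_alternating_kern harmonic2 M.
rewrite (eq_big_nat _ _ (F2 := fun n => 4%:R * (central_term n / n%:R ^+ 2) -
  4%:R * (harmonic2 n * central_term n) - 2%:R * ((-1) ^+ n.-1 / n%:R ^+ 4))); last first.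
  move=> n /andP[n0 _]; under eq_bigr do rewrite mulrCA.
  rewrite -mulr_sumr sum_kern_harmonic2 //.
  have n1 : n%:R != 0 :> R by rewrite pnatr_eq0; lia.
  set s := (-1) ^+ _; have ss : s * s = 1 by rewrite -expr2 sqrr_sign.
  transitivity (s * s * (4%:R * (central_term n / n%:R ^+ 2) -
    4%:R * (harmonic2 n * central_term n)) - 2%:R * (s / n%:R ^+ 4)); first by field.
  by rewrite ss; field.
rewrite ![\sum_(_ <= _ < _) (_ - _)]big_split /= !sumrN -!mulr_sumr.
by move=> e; lra.
Qed.

(** * Size of the boundary terms *)

Lemma apery_ge0 n k : 0 <= apery n k.
Proof. by rewrite /apery divr_ge0. Qed.

Lemma central_term_ge0 n : 0 <= central_term n.
Proof. by rewrite /central_term invr_ge0 mulr_ge0. Qed.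

(** Follows from [a! b! <= (a+b)!], used once for [(k-1)! (n-k)!] and once for [n! (k-1)!]. The
    bound is uniform in [k], so a weighted sum of [n] such terms is [O(1/n)]. *)
Lemma apery_le n k : (0 < k <= n)%N -> apery n k <= (n%:R ^+ 2)^-1.
Proof.
case: k => // k; case: n => // n /= kn; rewrite /apery subSS /=.
rewrite -natrX ler_pdivrMr ?ltr0n ?fact_gt0 // mulrC ler_pdivlMr ?ltr0n ?expn_gt0 //.
rewrite -natrM ler_nat addnS factS.
have kn1 : (k <= n)%N by lia.
have /(leq_trans _) h1 : (k`! * (n - k)`! <= n`!)%N.
  by rewrite -(bin_fact kn1) leq_pmull // bin_gt0.
have h2 : (n.+1`! * k`! <= (n.+1 + k)`!)%N.
  rewrite -(bin_fact (leq_addr k n.+1)) addKn leq_pmull // bin_gt0 leq_addr //.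
have {h1} h1 : (k`! * (n - k)`! <= n`!)%N by apply: h1.
rewrite [leqRHS]mulnC; apply: leq_trans (leq_mul h2 (_ : n.+1 <= _)%N); last by lia.
rewrite factS; have := leq_mul (leqnn (k`! * n.+1 ^ 2)) h1.
by rewrite !expnS !expn0 !muln1; congr leq; ring.
Qed.

(* With [F = \sum_n g_n t^n], the recurrence below reads
   [t (4 - t) F'' + (2 - t) F' = 1]; it forces [(4 - t) (t F')^2 = 2 t F], the
   first identity below, and then a similar equation for [F ^ 2]. *)
Section ConvolutionSquare.
Context (g : nat -> R) (g0 : g 0 = 0) (g1 : g 1 = 2%:R^-1)
  (gS : forall n, (0 < n)%N ->
    (4%:R * n.+1%:R ^+ 2 - 2%:R * n.+1%:R) * g n.+1 = n%:R ^+ 2 * g n).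

Let conv (u v : nat -> R) n := \sum_(0 <= i < n.+1) u i * v (n - i)%N.

Let convC u v n : conv u v n = conv v u n.
Proof.
rewrite /conv big_nat_rev /=; apply: eq_big_nat => i /andP[_ ni].
by rewrite add0n subSS subKn 1?mulrC //; lia.
Qed.

(** The Euler operator [t d/dt] acting on coefficients. *)
Let th (u : nat -> R) i := i%:R * u i.

(** Leibniz rule for the Euler operator, from [n = i + (n - i)]. *)
Let conv_th u v n : n%:R * conv u v n = conv (th u) v n + conv u (th v) n.
Proof.
rewrite mulr_sumr -big_split /=; apply: eq_big_nat => i /andP[_ ni].
have -> : n%:R = i%:R + (n - i)%:R :> R by rewrite -natrD subnKC //; lia.
by rewrite /th; ring.
Qed.

(** The recurrence [gS], as an equation between power series, multiplied by the series of [v]. The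
    term [v n] comes from the initial value [g1], as [gS] starts at [1]. *)
Let conv_rec v n :
  4%:R * conv (th (th g)) v n.+1 - 2%:R * conv (th g) v n.+1 =
  v n + conv (th (th g)) v n.
Proof.
rewrite /conv 2!mulr_sumr -sumrB big_nat_recl //.
rewrite big_nat_recl // [X in _ = _ + X]big_nat_recl //.
rewrite (eq_big_nat _ _ (F2 := fun i => th (th g) i.+1 * v (n - i.+1)%N)).
  by rewrite /th g1 subSS !subn0; field.
move=> i _; rewrite subSS.
have := gS i.+1 isT; rewrite /th => e.
by have := congr1 (fun z => z * v (n - i.+1)%N) e; rewrite /= => e'; lra.
Qed.

Let w n := conv (th g) (th g) n.
Let h n := conv g g n.

(** By the Leibniz rule [n w n] is twice the convolution of [th (th g)] with [th g], so [conv_rec]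
    at [v = th g] yields [n] times the claim. *)
Let w_rec n : (0 < n)%N -> 4%:R * w n.+1 - w n = 2%:R * g n.
Proof.
move=> n0; have nn : n%:R != 0 :> R by rewrite pnatr_eq0; lia.
apply: (mulfI nn).
have := conv_rec (th g) n.
have e m : m%:R * w m = 2%:R * conv (th (th g)) (th g) m.
  by rewrite conv_th [X in _ + X]convC; ring.
have := e n; have := e n.+1; rewrite -/(w _) -(natr1 n).
have -> : th g n = n%:R * g n by [].
by move=> *; lra.
Qed.

(** This is [conv_rec] at [v = g], with both convolutions expressed through [h] and [w]. There [w]
    occurs as [8 w n.+1 - 2 w n], which [w_rec] turns into [4 g n]. *)
Let h_rec n : (0 < n)%N ->
  (4%:R * n.+1%:R ^+ 2 - 2%:R * n.+1%:R) * h n.+1 =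
  n%:R ^+ 2 * h n + 6%:R * g n.
Proof.
move=> n0; have := conv_rec g n.
have e m : m%:R * h m = 2%:R * conv (th g) g m.
  by rewrite conv_th [X in _ + X]convC; ring.
have e2 m : m%:R ^+ 2 * h m = 2%:R * conv (th (th g)) g m + 2%:R * w m.
  by rewrite expr2 -mulrA e mulrCA conv_th -/(w _); ring.
have := e n.+1; have := e2 n; have := e2 n.+1; have := w_rec n n0.
rewrite -/(h _) -/(w _); move=> *; lra.
Qed.

(** Both sides satisfy [h_rec]: the growth [1/n^2] of [harmonic2], multiplied by [gS], produces
    exactly the extra [6 g n]. *)
Lemma convolution_square n :
  \sum_(0 <= i < n.+1) g i * g (n - i)%N = 6%:R * harmonic2 n * g n.
Proof.
rewrite -/(conv g g n) -/(h n).
elim: n => [|n IH]; first by rewrite /h /conv big_nat1 g0 !mulr0.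
case: n IH => [_|n IH].
  rewrite /h /conv big_nat_recr //= big_nat1 g0 mul0r mulr0 add0r.
  by rewrite /harmonic2 big_geq // mulr0 mul0r.
have nn : 4%:R * n.+2%:R ^+ 2 - 2%:R * n.+2%:R != 0 :> R.
  rewrite lt0r_neq0 // -(natr1 n.+1); have : 0 < n.+1%:R :> R by rewrite ltr0n.
  set x := n.+1%:R => x0; nra.
apply: (mulfI nn); rewrite h_rec // IH (@harmonic2S n.+1) //.
transitivity (6%:R * (harmonic2 n.+1 + (n.+1%:R ^+ 2)^-1) * (n.+1%:R ^+ 2 * g n.+1)).
  have n1 : n.+1%:R != 0 :> R by rewrite pnatr_eq0.
  by field; rewrite nat1r.
by rewrite -gS //; ring.
Qed.

End ConvolutionSquare.

End AperySums.

(** * Euler's relation between zeta(2)^2 and zeta(4) *)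

Section EulerRelation.
Context {R : realFieldType}.
Implicit Types n k m : nat.

(** A symmetric kernel chosen for [euler_kernelP]: when that identity is summed over all [m] and
    [n], the off-diagonal values cancel and the diagonal ones, [(5/2) / n^4], remain. *)
Definition euler_kernel m n : R :=
  (m%:R * n%:R ^+ 3)^-1 + (2%:R * m%:R ^+ 2 * n%:R ^+ 2)^-1 + (m%:R ^+ 3 * n%:R)^-1.

Lemma euler_kernelP m n : (0 < m)%N -> (0 < n)%N ->
  (m%:R ^+ 2)^-1 * (n%:R ^+ 2)^-1 =
  euler_kernel m n - euler_kernel (m + n) n - euler_kernel (m + n) m.
Proof.
move=> m0 n0; rewrite /euler_kernel natrD.
have : 0 < m%:R :> R by rewrite ltr0n.
have : 0 < n%:R :> R by rewrite ltr0n.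
set x := m%:R; set y := n%:R => y0 x0.
by field; rewrite !lt0r_neq0 //; lra.
Qed.

(** The kernel values with first argument above [M] that the identity on the square [m, n <= M]
    produces and that nothing cancels. *)
Definition euler_remainder M : R :=
  \sum_(1 <= n < M.+1) \sum_(1 <= i < n.+1) euler_kernel (M + i) n.

Lemma euler_partial M :
  (\sum_(1 <= n < M.+1) (n%:R ^+ 2)^-1) ^+ 2 =
  5%:R / 2%:R * \sum_(1 <= n < M.+1) (n%:R ^+ 4)^-1 - 2%:R * euler_remainder M.
Proof.
elim: M => [|M IH].
  by rewrite /euler_remainder !big_geq // !mulr0 expr2 mul0r subrr.
(* Raising [M] by one shifts the window [M+1, ..., M+n] of an inner sum, so only its ends change. *)
have tele (f : nat -> R) n :
    \sum_(1 <= i < n.+1) f (M.+1 + i)%N - \sum_(1 <= i < n.+1) f (M + i)%N =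
    f (M.+1 + n)%N - f M.+1.
  elim: n => [|n IHn]; first by rewrite !big_geq // addn0 !subrr.
  by rewrite !(@big_nat_recr _ _ _ n.+1) //= opprD addrACA IHn (addnS M) addSn; ring.
have step : euler_remainder M.+1 - euler_remainder M =
    \sum_(1 <= n < M.+1) (euler_kernel (M.+1 + n) n - euler_kernel M.+1 n)
    + \sum_(1 <= n < M.+2) euler_kernel (M.+1 + n) M.+1.
  rewrite {1}/euler_remainder big_nat_recr //= addrAC; congr (_ + _).
  rewrite -sumrB; apply: eq_big_nat => n /andP[n0 _].
  exact: (tele (euler_kernel^~ n)).
have -> : euler_remainder M.+1 = euler_remainder M + (euler_remainder M.+1 - euler_remainder M).
  by rewrite addrC subrK.
rewrite step ![\sum_(1 <= _ < M.+2) _]big_nat_recr //= sqrrD IH.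
have -> : euler_kernel (M.+1 + M.+1) M.+1 = 3%:R / 4%:R * (M.+1%:R ^+ 4)^-1.
  have : 0 < M.+1%:R :> R by rewrite ltr0n.
  rewrite /euler_kernel natrD; move: (M.+1%:R) => x x0.
  by field; rewrite !lt0r_neq0 //; lra.
(* The cross term of the square cancels the growth of the remainder found in [step], except for its
   last term, evaluated just above. *)
have -> : (\sum_(1 <= n < M.+1) (n%:R ^+ 2)^-1) * (M.+1%:R ^+ 2)^-1 =
  - (\sum_(1 <= n < M.+1) (euler_kernel (M.+1 + n) n - euler_kernel M.+1 n) +
     \sum_(1 <= n < M.+1) euler_kernel (M.+1 + n) M.+1).
  rewrite -big_split mulr_suml -sumrN; apply: eq_big_nat => n /andP[n0 _].
  by rewrite /= mulrC euler_kernelP //; ring.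
have -> : ((M.+1%:R ^+ 2)^-1) ^+ 2 = (M.+1%:R ^+ 4)^-1 :> R.
  by rewrite exprVn -exprM.
by move: (M.+1%:R ^- 4) => x; field.
Qed.

Lemma euler_remainder_ge0 M : 0 <= euler_remainder M.
Proof.
apply: sumr_ge0 => n _; apply: sumr_ge0 => i _.
by rewrite /euler_kernel !addr_ge0 // invr_ge0 ?mulr_ge0 ?exprn_ge0.
Qed.

(** As [M + i >= M >= n], each of the [n] inner terms is at most [(5/2) / (M n^3)]; the sum of
    [1/n^2] is at most [2]. *)
Lemma euler_remainder_le M : (0 < M)%N -> euler_remainder M <= 5%:R / M%:R.
Proof.
move=> M0; have x0 : 0 < M%:R :> R by rewrite ltr0n.
apply: (@le_trans _ _ (\sum_(1 <= n < M.+1) 5%:R / 2%:R / M%:R * (n%:R ^+ 2)^-1)).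
  apply: ler_sum_nat => n /andP[n0 nM].
  have y0 : 0 < n%:R :> R by rewrite ltr0n.
  have -> : 5%:R / 2%:R / M%:R * (n%:R ^+ 2)^-1 =
      \sum_(1 <= i < n.+1) 5%:R / 2%:R * (M%:R * n%:R ^+ 3)^-1 :> R.
    by rewrite sumr_const_nat subn1 /= -[RHS]mulr_natr; field; rewrite !lt0r_neq0.
  apply: ler_sum_nat => i _; rewrite /euler_kernel natrD.
  have : n%:R <= M%:R :> R by rewrite ler_nat.
  have : 0 <= i%:R :> R by [].
  move: y0 x0; set x := M%:R; set y := n%:R; set z := i%:R => y0 x0 z0 yx.
  have e1 : ((x + z) * y ^+ 3)^-1 <= (x * y ^+ 3)^-1.
    by rewrite lef_pV2 ?posrE ?mulr_gt0 ?exprn_gt0 ?ler_wpM2r ?exprn_ge0; lra.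
  have e2 : (2 * (x + z) ^+ 2 * y ^+ 2)^-1 <= 2%:R^-1 * (x * y ^+ 3)^-1.
    rewrite -invfM lef_pV2 ?posrE ?mulr_gt0 ?exprn_gt0; try lra.
    rewrite -mulrA ler_wpM2l // exprSr mulrA mulrAC ler_wpM2r ?exprn_ge0 //; try lra.
    by rewrite expr2 ler_pM; lra.
  have e3 : ((x + z) ^+ 3 * y)^-1 <= (x * y ^+ 3)^-1.
    rewrite lef_pV2 ?posrE ?mulr_gt0 ?exprn_gt0; try lra.
    rewrite exprSr mulrA ler_wpM2r ?exprSr ?expr1 ?[x * (_ * _)]mulrC ?expr0 ?mul1r; try lra.
    by rewrite ler_pM ?mulr_ge0 // ?ler_pM; lra.
  lra.
rewrite -mulr_sumr.
have : \sum_(1 <= n < M.+1) (n%:R ^+ 2)^-1 <= 2%:R :> R by apply: harmonic2_le2.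
have : 0 < 5%:R / 2%:R / M%:R :> R by rewrite divr_gt0 //; lra.
move=> c0 h; apply: le_trans (ler_wpM2l (ltW c0) h) _.
by rewrite le_eqVlt; apply/orP; left; apply/eqP; field; rewrite lt0r_neq0.
Qed.

(** The alternating sum is the full sum minus twice its even-indexed part, [2 / (2n)^s]. *)
Lemma eta_partial s M :
  \sum_(1 <= n < (2 * M).+1) (-1) ^+ n.-1 / n%:R ^+ s =
  \sum_(1 <= n < (2 * M).+1) (n%:R ^+ s)^-1
  - 2%:R / 2%:R ^+ s * \sum_(1 <= n < M.+1) (n%:R ^+ s)^-1 :> R.
Proof.
elim: M => [|M IH]; first by rewrite muln0 !big_geq // mulr0 subr0.
have recr (f : nat -> R) n :
    \sum_(1 <= i < n.+2) f i = \sum_(1 <= i < n.+1) f i + f n.+1.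
  by rewrite big_nat_recr.
rewrite mulnS !addSn add0n !recr IH /=.
have -> : (2 * M).+2 = (2 * M.+1)%N by lia.
rewrite natrM exprMn invfM exprS exprM sqrrN !expr1n; ring.
Qed.
End EulerRelation.

(** * Dirichlet and Cauchy products of series *)

Section SeriesProducts.
Local Open Scope classical_set_scope.
Context {R : realType}.
Implicit Types (f g : nat -> R) (F G : R).

(** The sums over squares converge to [F * G]. A region that eventually contains every fixed square
    [K x K] omits only pairs outside it, whose absolute mass is small. Dirichlet and Cauchy products
    are the regions [i j < M] and [i + j < M]. *)
Lemma cvg_sum_region f g F G (D : nat -> nat -> nat -> bool) :
  series f @ \oo --> F -> series g @ \oo --> G ->
  cvgn (series (fun n => `|f n|)) -> cvgn (series (fun n => `|g n|)) ->
  (forall K, exists M0, forall M i j,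
     (M0 <= M)%N -> (i < K)%N -> (j < K)%N -> D M i j) ->
  (fun M => \sum_(0 <= i < M) \sum_(0 <= j < M | D M i j) f i * g j)
    @ \oo --> F * G.
Proof.
move=> cf cg nf ng covD.
pose sq (u v : nat -> R) M := series u M * series v M.
have sqE u v M : sq u v M = \sum_(0 <= i < M) \sum_(0 <= j < M) u i * v j.
  by rewrite /sq /series /= big_distrlr.
pose reg (u v : nat -> R) M := \sum_(0 <= i < M) \sum_(0 <= j < M | D M i j) u i * v j.
have split u v M : sq u v M - reg u v M =
    \sum_(0 <= i < M) \sum_(0 <= j < M | ~~ D M i j) u i * v j.
  rewrite sqE -sumrB; apply: eq_bigr => i _.
  by rewrite [X in X - _](bigID (D M i)) /= addrC addrK.
have csq : sq f g @ \oo --> F * G by apply: cvgM.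
rewrite -[X in _ --> X]subr0.
rewrite (_ : (fun M => _) = (fun M => sq f g M - (sq f g M - reg f g M))); last first.
  by apply/funext => M; rewrite opprB addrC subrK.
apply: cvgB => //; apply/cvgrPdist_le => e e0.
pose a n := `|f n|; pose b n := `|g n|.
have /cvgrPdist_lt hQ : sq a b @ \oo --> limn (series a) * limn (series b) by apply: cvgM.
have e2 : 0 < e / 2%:R by rewrite divr_gt0.
have [K _ hK] := hQ _ e2.
have [M0 hM0] := covD K.
exists (maxn K M0) => // M /=; rewrite geq_max => /andP[KM M0M].
rewrite sub0r normrN split.
apply: (@le_trans _ _ (sq a b M - reg a b M)).
  rewrite split; apply: le_trans (ler_norm_sum _ _ _) _; apply: ler_sum => i _.
  apply: le_trans (ler_norm_sum _ _ _) _; apply: ler_sum => j _.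
  by rewrite normrM.
(* With absolute values the region dominates the square [K x K], so the omitted mass is at most the
   growth of [sq a b] from [K] to [M]. *)
have : sq a b K <= reg a b M.
  rewrite sqE (big_nat_widen _ _ M) //= big_mkcond /=; apply: ler_sum_nat => i iM.
  have ab0 j : 0 <= a i * b j by rewrite mulr_ge0 ?normr_ge0.
  case: ifP => iK; last by apply: sumr_ge0.
  rewrite (big_nat_widen _ _ M) //= big_mkcond [leRHS]big_mkcond /=.
  apply: ler_sum_nat => j jM; case: ifP => jK; first by rewrite hM0.
  by case: ifP.
have := hK M KM; have := hK K (leqnn K); rewrite /= -/(sq a b M) -/(sq a b K).
set L := _ * _; rewrite !ltr_norml => /andP[h1 h2] /andP[h3 h4]; lra.
Qed.

Lemma sum_divisors_nat (V : nmodType) (F : nat -> V) n M : (0 < n)%N -> (n < M)%N ->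
  \sum_(d <- divisors n) F d = \sum_(0 <= d < M | (d %| n)%N) F d.
Proof.
move=> n0 nM; rewrite -[RHS]big_filter; apply: perm_big; apply: uniq_perm.
- exact: divisors_uniq.
- by rewrite filter_uniq // iota_uniq.
move=> d; rewrite -dvdn_divisors // mem_filter mem_index_iota /=.
by case: (boolP (d %| n)%N) => // /(dvdn_leq n0) dn; lia.
Qed.

(** Divisor sums become sums over a box of pairs, where the order of summation can be exchanged. *)
Lemma sum_divisors (V : nmodType) (F : nat -> nat -> V) n M : (0 < n)%N -> (n < M)%N ->
  \sum_(d <- divisors n) F d (n %/ d)%N =
  \sum_(0 <= a < M) \sum_(0 <= b < M | (a * b == n)%N) F a b.
Proof.
move=> n0 nM; rewrite (sum_divisors_nat _ _ _ M) // big_mkcond; apply: eq_big_nat.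
move=> a _; case: ifPn => [/dvdnP[b ne]|nd].
  have a0 : (0 < a)%N by lia.
  rewrite ne mulnK // -ne.
  rewrite big_mkcond (bigD1_seq b) ?iota_uniq ?mem_index_iota //=; last by nia.
  rewrite mulnC -ne eqxx big1 ?addr0 // => j jb; case: eqP => // e.
  by case/eqP: jb; apply/eqP; rewrite -(eqn_pmul2l a0) e ne mulnC.
rewrite big_pred0 // => b; apply/negP => /eqP e; case/negP: nd.
by rewrite -e dvdn_mulr.
Qed.

Lemma cvg_dirichlet f g F G : f 0 = 0 -> g 0 = 0 ->
  series f @ \oo --> F -> series g @ \oo --> G ->
  cvgn (series (fun n => `|f n|)) -> cvgn (series (fun n => `|g n|)) ->
  series (fun n => \sum_(d <- divisors n) f d * g (n %/ d)%N) @ \oo --> F * G.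
Proof.
move=> f0 g0 cf cg nf ng.
have cov K : exists M0, forall M i j,
     (M0 <= M)%N -> (i < K)%N -> (j < K)%N -> (i * j < M)%N.
  exists (K * K)%N => M i j h iK jK; apply: leq_trans h.
  by apply: ltn_mul.
suff <- : (fun M => \sum_(0 <= i < M) \sum_(0 <= j < M | (i * j < M)%N) f i * g j) =
    series (fun n => \sum_(d <- divisors n) f d * g (n %/ d)%N).
  exact: (@cvg_sum_region f g F G (fun M i j => (i * j < M)%N)).
apply/funext => M; rewrite /series /= [RHS](eq_big_nat _ _ (F2 := fun n =>
  \sum_(0 <= a < M) \sum_(0 <= b < M) if (a * b == n)%N then f a * g b else 0)).
  rewrite [RHS]exchange_big /=; apply: eq_bigr => a _.
  rewrite [RHS]exchange_big /= big_mkcond /=; apply: eq_bigr => b _.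
  case: ifPn => ab.
    rewrite (bigD1_seq (a * b)%N) ?iota_uniq ?mem_index_iota //= eqxx.
    by rewrite big1 ?addr0 // => n; rewrite eq_sym => /negPf ->.
  rewrite big1_seq // => n; rewrite mem_index_iota /= => nM.
  by case: eqP => // e; move: ab; rewrite e nM.
move=> n /andP[_ nM]; case: n nM => [M0|n nM].
  (* At index [0], [divisors 0] is the list of the single element [1]; its term, like all pairs of
     product [0], vanishes by [f0] and [g0]. *)
  rewrite big_seq1 divn1 g0 mulr0 big1 // => a _; rewrite big1 // => b _.
  by case: ifP => //; rewrite muln_eq0 => /orP[]/eqP ->; rewrite ?f0 ?g0 ?mul0r ?mulr0.
rewrite (@sum_divisors _ (fun a b => f a * g b) _ M) //.
by apply: eq_bigr => a _; rewrite big_mkcond.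
Qed.

Lemma cvg_cauchy_product f g F G :
  series f @ \oo --> F -> series g @ \oo --> G ->
  cvgn (series (fun n => `|f n|)) -> cvgn (series (fun n => `|g n|)) ->
  series (fun n => \sum_(0 <= i < n.+1) f i * g (n - i)%N) @ \oo --> F * G.
Proof.
move=> cf cg nf ng.
have cov K : exists M0, forall M i j,
     (M0 <= M)%N -> (i < K)%N -> (j < K)%N -> (i + j < M)%N.
  by exists (K + K)%N => M i j h iK jK; lia.
suff <- : (fun M => \sum_(0 <= i < M) \sum_(0 <= j < M | (i + j < M)%N) f i * g j) =
    series (fun n => \sum_(0 <= i < n.+1) f i * g (n - i)%N).
  exact: (@cvg_sum_region f g F G (fun M i j => (i + j < M)%N)).
apply/funext => M; rewrite /series /=.
rewrite [RHS](eq_big_nat _ _ (F2 := fun n =>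
  \sum_(0 <= a < M) \sum_(0 <= b < M) if (a + b == n)%N then f a * g b else 0)).
  rewrite [RHS]exchange_big /=; apply: eq_bigr => a _.
  rewrite [RHS]exchange_big /= big_mkcond /=; apply: eq_bigr => b _.
  case: ifPn => ab.
    rewrite (bigD1_seq (a + b)%N) ?iota_uniq ?mem_index_iota //= eqxx.
    by rewrite big1 ?addr0 // => n; rewrite eq_sym => /negPf ->.
  rewrite big1_seq // => n; rewrite mem_index_iota /= => nM.
  by case: eqP => // e; move: ab; rewrite e nM.
move=> n /andP[_ nM].
rewrite (big_nat_widen _ _ M) //= big_mkcond /=; apply: eq_big_nat => a /andP[_ aM].
case: ifP => an.
  rewrite (bigD1_seq (n - a)%N) ?iota_uniq ?mem_index_iota //=; last by lia.
  rewrite subnKC ?eqxx; last by lia.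
  by rewrite big1 ?addr0 // => j jb; case: eqP => // e; lia.
by rewrite big1 // => j _; case: eqP => // e; lia.
Qed.

(** * Series dominated by inverse powers *)

Definition powinv s n : R := (n%:R ^+ s)^-1.

(** The inverse of zero is zero, so series indexed from [0] agree with sums from [1]. *)
Lemma powinv0 s : (0 < s)%N -> powinv s 0 = 0.
Proof. by case: s => // s _; rewrite /powinv expr0n invr0. Qed.

Lemma powinv_ge0 s n : 0 <= powinv s n.
Proof. by rewrite /powinv invr_ge0 exprn_ge0. Qed.

Lemma powinv_le s n : (2 <= s)%N -> powinv s n <= powinv 2 n.
Proof.
case: n => [|n] s2; first by rewrite !powinv0 //; lia.
by rewrite /powinv lef_pV2 ?posrE ?exprn_gt0 ?ltr0n // ler_weXn2l // ler1n.
Qed.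

Lemma series1 f M : f 0 = 0 -> series f M.+1 = \sum_(1 <= n < M.+1) f n.
Proof. by move=> f0; rewrite /series /= big_ltn // f0 add0r. Qed.

Lemma is_cvg_powinv s : (2 <= s)%N -> cvgn (series (powinv s)).
Proof.
move=> s2; apply: (series_le_cvg (v_ := powinv 2)) => [n|n|n|].
- exact: powinv_ge0.
- exact: powinv_ge0.
- exact: powinv_le.
apply: nondecreasing_is_cvgn.
  apply/nondecreasing_seqP => n; rewrite /series /= big_nat_recr //= lerDl; exact: powinv_ge0.
exists 2%:R => _ [[|M] _ <-]; first by rewrite /series /= big_geq.
by rewrite series1 ?powinv0 //; apply: harmonic2_le2.
Qed.

Lemma cvg_seriesM c f F :
  series f @ \oo --> F -> series (fun n => c * f n) @ \oo --> c * F.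
Proof.
move=> cf; rewrite (_ : series _ = (fun M => c * series f M)); first exact: cvgMl_tmp.
by apply/funext => M; rewrite /series /= mulr_sumr.
Qed.

Lemma is_cvg_norm_series f c s : (2 <= s)%N ->
  (forall n, `|f n| <= c * powinv s n) -> cvgn (series (fun n => `|f n|)).
Proof.
move=> s2 fc; apply: (series_le_cvg (v_ := fun n => c * powinv s n)) => // [n|].
  by apply: le_trans (fc n).
by have /cvgP := cvg_seriesM c _ _ (is_cvg_powinv s s2).
Qed.

Lemma cvg0_le_inv (u : nat -> R) c :
  (forall M, (0 < M)%N -> `|u M| <= c / M%:R) -> u @ \oo --> 0.
Proof.
move=> uc; apply/norm_cvg0P.
have h : (fun M => c * M%:R^-1) @ \oo --> (0 : R).
  rewrite -[X in _ --> X](mulr0 c); apply: cvgMl_tmp; rewrite -cvg_shiftS; exact: cvg_harmonic.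
apply: squeeze_cvgr (cvg_cst 0) h.
by exists 1%N => // M /= M0; rewrite normr_ge0 uc.
Qed.
End SeriesProducts.

(** * Central binomial series *)

Section CentralBinomialSeries.
Local Open Scope classical_set_scope.
Context {R : realType}.
Implicit Types (f g h : nat -> R) (c : R).
Let G := @central_term R.
Let H := @harmonic2 R.
Let p := @powinv R.

Lemma cvg_subseq (u : nat -> R) (l : R) (k : nat -> nat) :
  (forall M, (M <= k M)%N) -> u @ \oo --> l -> (fun M => u (k M)) @ \oo --> l.
Proof.
move=> kM /cvgrPdist_le ul; apply/cvgrPdist_le => e e0.
have [M0 _ h] := ul _ e0.
by exists M0 => // M /= M0M; apply: h => /=; apply: leq_trans (kM M).
Qed.

(** There are [M] terms, each at most [c / M^2] by [apery_le]. *)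
Lemma apery_error h c M : (0 < M)%N -> (forall k, `|h k| <= c) ->
  `|\sum_(1 <= k < M.+1) h k * apery M k| <= c / M%:R.
Proof.
move=> M0 hc; apply: le_trans (ler_norm_sum _ _ _) _.
have x0 : 0 < M%:R :> R by rewrite ltr0n.
have -> : c / M%:R = \sum_(1 <= k < M.+1) c * (M%:R ^+ 2)^-1.
  by rewrite sumr_const_nat subn1 /= -[RHS]mulr_natr; field; rewrite lt0r_neq0.
apply: ler_sum_nat => k kM; rewrite normrM (ger0_norm (apery_ge0 M k)).
by apply: ler_pM; rewrite ?apery_ge0 ?apery_le.
Qed.

Lemma apery_error_cvg0 h c (s : nat -> R) : (forall k, `|h k| <= c) ->
  (forall M, `|s M| <= 1) ->
  (fun M => s M * \sum_(1 <= k < M.+1) h k * apery M k) @ \oo --> (0 : R).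
Proof.
move=> hc s1; apply: (@cvg0_le_inv _ _ c) => M M0; rewrite normrM -[leRHS]mul1r.
by apply: ler_pM => //; exact: apery_error.
Qed.

Lemma central_termE n : G n = 'C(2 * n, n)%:R^-1 * p 2 n.
Proof. by rewrite /G /central_term /p /powinv invfM natrX mulrC. Qed.

Lemma central_term0 : G 0 = 0.
Proof. by rewrite central_termE /p powinv0 // mulr0. Qed.

Lemma central_term_le n : G n <= p 2 n.
Proof.
case: n => [|n]; first by rewrite central_term0 /p powinv0.
by rewrite /G -apery_diag // apery_le // leqnn.
Qed.

Lemma is_cvg_central f c : (forall n, `|f n| <= c) ->
  cvgn (series (fun n => `|f n * G n|)).
Proof.
move=> fc; apply: (@is_cvg_norm_series _ _ c 2) => // n.
rewrite normrM ler_pM //.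
rewrite ger0_norm; [exact: central_term_le|exact: central_term_ge0].
Qed.

Lemma is_cvg_series_central f c : (forall n, `|f n| <= c) ->
  cvgn (series (fun n => f n * G n)).
Proof. by move=> fc; apply: normed_cvg; apply: (is_cvg_central _ c). Qed.

Lemma is_cvg_central_term : cvgn (series G).
Proof.
rewrite (_ : G = fun n => 1 * G n); last by apply/funext => n; rewrite mul1r.
by apply: (is_cvg_series_central _ 1) => n; rewrite normr1.
Qed.

Definition zeta s : R := limn (series (p s)).

Lemma cvg_zeta s : (2 <= s)%N -> series (p s) @ \oo --> zeta s.
Proof. exact: is_cvg_powinv. Qed.

(** Even truncations are those that [eta_partial] covers; a subsequence suffices to identify
    limits. *)
Lemma cvg_eta s : (2 <= s)%N ->
  (fun M => \sum_(1 <= n < (2 * M).+1) (-1) ^+ n.-1 / n%:R ^+ s)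
    @ \oo --> (1 - 2%:R / 2%:R ^+ s) * zeta s.
Proof.
move=> s2; rewrite mulrBl mul1r.
rewrite (_ : (fun M => _) = fun M => series (p s) (2 * M).+1 -
  2%:R / 2%:R ^+ s * series (p s) M.+1); last first.
  by apply/funext => M; rewrite eta_partial !series1 // /p powinv0 //; lia.
have c1 : (fun M => series (p s) (2 * M).+1) @ \oo --> zeta s.
  by apply: (@cvg_subseq (series (p s)) _ (fun M => (2 * M).+1)) => [M|]; [lia|exact: cvg_zeta].
have c2 : (fun M => series (p s) M.+1) @ \oo --> zeta s.
  by apply: (@cvg_subseq (series (p s)) _ (fun M => M.+1)) => [M|]; [lia|exact: cvg_zeta].
by apply: cvgB => //; apply: cvgMl_tmp.
Qed.

Lemma sign_le1 n : `|(-1) ^+ n| <= 1 :> R.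
Proof. by rewrite normrX normrN normr1 expr1n. Qed.

Lemma cvg_eq_lim (u v : nat -> R) (a b : R) :
  u @ \oo --> a -> v @ \oo --> b -> u =1 v -> a = b.
Proof.
move=> ua vb /funext uv; rewrite uv in ua.
exact: cvg_unique ua vb.
Qed.

Lemma cvg_even (u : nat -> R) (l : R) : u @ \oo --> l -> (fun M => u (2 * M)%N) @ \oo --> l.
Proof. by apply: cvg_subseq => M; lia. Qed.

Lemma cvg_series1 f (l : R) : f 0 = 0 -> series f @ \oo --> l ->
  (fun M => \sum_(1 <= n < M.+1) f n) @ \oo --> l.
Proof.
move=> f0 fl; rewrite (_ : (fun M => _) = fun M => series f M.+1).
  by apply: (@cvg_subseq (series f) l S).
by apply/funext => M; rewrite series1.
Qed.

Lemma cvg_alternating_error h c : (forall k, `|h k| <= c) ->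
  (fun M => 2%:R^-1 * (-1) ^+ M.-1 * \sum_(1 <= k < M.+1) h k * apery M k)
     @ \oo --> (0 : R).
Proof.
move=> hc; apply: (apery_error_cvg0 _ c) => // M.
by rewrite normrM ger0_norm //; have := sign_le1 M.-1; lra.
Qed.

Let cvgnD (u v : nat -> R) (a b : R) : u @ \oo --> a -> v @ \oo --> b ->
  (fun M => u M + v M) @ \oo --> a + b.
Proof. exact: cvgD. Qed.

Let cvgnB (u v : nat -> R) (a b : R) : u @ \oo --> a -> v @ \oo --> b ->
  (fun M => u M - v M) @ \oo --> a - b.
Proof. exact: cvgB. Qed.

Let cvgnZ c (u : nat -> R) (a : R) : u @ \oo --> a ->
  (fun M => c * u M) @ \oo --> c * a.
Proof. exact: cvgMl_tmp. Qed.

(** The limit of [eta2_partial] along even [M] reads [zeta 2 / 2 = (3/2) S]. *)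
Lemma series_central2 : series G @ \oo --> zeta 2 / 3%:R.
Proof.
have cG := is_cvg_central_term.
suff -> : zeta 2 / 3%:R = limn (series G) by [].
have c1 := cvg_even _ _ (cvg_series1 _ _ central_term0 cG).
have c2 := cvg_even _ _ (cvg_alternating_error (fun k => (-1) ^+ k.-1) 1 (fun=> sign_le1 _)).
have c3 := cvgnD _ _ _ _ (cvgnZ (3%:R / 2%:R) _ _ c1) c2.
have := cvg_eq_lim _ _ _ _ (cvg_eta 2 isT) c3 (fun=> eta2_partial _).
have -> : 1 - 2%:R / 2%:R ^+ 2 = 2%:R^-1 :> R by field.
by move=> e; lra.
Qed.

Lemma harmonic2_norm n : `|H n| <= 2%:R.
Proof. by rewrite ger0_norm ?harmonic2_le2 // harmonic2_ge0. Qed.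

Lemma series_central3 :
  series (fun n => (-1) ^+ n.-1 * G n / n%:R) @ \oo --> 2%:R / 5%:R * zeta 3.
Proof.
have hb k : `|(-1) ^+ k.-1 / k%:R| <= 1 :> R.
  rewrite normrM normfV normr_nat -[leRHS]mulr1.
  apply: ler_pM => //; first exact: sign_le1.
  by case: k => [|k]; rewrite ?invr0 // invf_le1 ?ltr0n // ler1n.
have cG : cvgn (series (fun n => (-1) ^+ n.-1 * G n / n%:R)).
  rewrite (_ : (fun n => _) = fun n => ((-1) ^+ n.-1 / n%:R) * G n).
    exact: (is_cvg_series_central _ 1).
  by apply/funext => n; ring.
suff -> : 2%:R / 5%:R * zeta 3 = limn (series (fun n => (-1) ^+ n.-1 * G n / n%:R)) by [].
have f0 : (-1) ^+ 0.-1 * G 0 / 0%:R = 0 by rewrite invr0 mulr0.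
have c1 := cvg_series1 _ _ f0 cG.
have s1 (M : nat) : `|2%:R^-1 : R| <= 1 by rewrite ger0_norm //; lra.
have c2 := apery_error_cvg0 _ 1 (fun=> 2%:R^-1) hb s1.
have c3 := cvgnB _ _ _ _ (cvgnZ (5%:R / 2%:R) _ _ c1) c2.
have c4 := cvg_series1 _ _ (powinv0 3 isT) (cvg_zeta 3 isT).
have := cvg_eq_lim _ _ _ _ c4 c3 (fun=> zeta3_partial _).
by move=> ->; move: (limn _) => L; rewrite subr0; field.
Qed.

Lemma euler_zeta4 : zeta 2 ^+ 2 = 5%:R / 2%:R * zeta 4.
Proof.
have c2 := cvg_series1 _ _ (powinv0 2 isT) (cvg_zeta 2 isT).
have c4 := cvg_series1 _ _ (powinv0 4 isT) (cvg_zeta 4 isT).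
have cr : (@euler_remainder R) @ \oo --> (0 : R).
  apply: (@cvg0_le_inv _ _ 5%:R) => M M0.
  by rewrite ger0_norm ?euler_remainder_ge0 // euler_remainder_le.
have c5 := cvgnB _ _ _ _ (cvgnZ (5%:R / 2%:R) _ _ c4) (cvgnZ 2%:R _ _ cr).
have c22 : (fun M => (\sum_(1 <= n < M.+1) p 2 n) ^+ 2) @ \oo --> zeta 2 ^+ 2.
  exact: (cvgM c2 c2).
by rewrite (cvg_eq_lim _ _ _ _ c22 c5 (fun=> euler_partial _)) mulr0 subr0.
Qed.

(** The ratio [C(2n+2, n+1) / C(2n, n) = 2 (2n+1) / (n+1)] in disguise; this is the recurrence that
    [convolution_square] asks for. *)
Lemma central_termS n : (0 < n)%N ->
  (4%:R * n.+1%:R ^+ 2 - 2%:R * n.+1%:R) * G n.+1 = n%:R ^+ 2 * G n.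
Proof.
case: n => // n _; rewrite /G -!apery_diag // /apery !subnn /= !addSn !addnS.
rewrite fact0 !muln1 (factS n) (factS (n + n).+3) (factS (n + n).+2).
have := @fact_neq0 R (n + n).+2; move: ((n + n).+2)`! => z; rewrite !natrM.
have : n.+1%:R != 0 :> R by rewrite pnatr_eq0.
have : (n + n).+4%:R != 0 :> R by rewrite pnatr_eq0.
have : (n + n).+3%:R != 0 :> R by rewrite pnatr_eq0.
have -> : (n + n).+4%:R = 2%:R * n%:R + 4%:R :> R by rewrite -!natr1 natrD; ring.
have -> : (n + n).+3%:R = 2%:R * n%:R + 3%:R :> R by rewrite -!natr1 natrD; ring.
have -> : n.+2%:R = n%:R + 2%:R :> R by rewrite -!natr1; ring.
have -> : n.+1%:R = n%:R + 1 :> R by rewrite -!natr1; ring.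
by move=> h3 h4 h1 z0; field; rewrite h3 h4 z0.
Qed.

(** The Cauchy square of the central series is six times this one by [convolution_square], and
    [(zeta 2 / 3)^2 / 6] is [zeta(2)^2 / 54]. *)
Lemma series_harmonic2_central :
  series (fun n => H n * G n) @ \oo --> zeta 2 ^+ 2 / 54%:R.
Proof.
have cn : cvgn (series (fun n => `|G n|)).
  rewrite (_ : (fun n => _) = G); first exact: is_cvg_central_term.
  by apply/funext => n; rewrite ger0_norm // central_term_ge0.
have := cvg_cauchy_product _ _ _ _ series_central2 series_central2 cn cn.
move=> /(cvg_seriesM 6%:R^-1).
have -> : 6%:R^-1 * (zeta 2 / 3%:R * (zeta 2 / 3%:R)) = zeta 2 ^+ 2 / 54%:R by field.
rewrite (_ : (fun n => _ * _) = (fun n => H n * G n)) //.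
apply/funext => n; rewrite convolution_square; first by rewrite -!mulrA mulKf.
- exact: central_term0.
- by rewrite -[LHS]/(central_term 1) -apery_diag // /apery /= mul1r.
- exact: central_termS.
Qed.

(** In the limit [eta4_partial] gives [(7/8) zeta 4 = 2 L - (3/2) zeta(2)^2 / 54]; by Euler's
    relation the last term is [(5/72) zeta 4], so [2 L = (17/18) zeta 4]. *)
Lemma series_central4 :
  series (fun n => G n / n%:R ^+ 2) @ \oo --> 17%:R / 36%:R * zeta 4.
Proof.
have cG : cvgn (series (fun n => G n / n%:R ^+ 2)).
  rewrite (_ : (fun n => _) = fun n => powinv 2 n * G n).
    apply: (is_cvg_series_central _ 1) => -[|n].
      by rewrite powinv0 // normr0.
    rewrite ger0_norm ?powinv_ge0 // /powinv invf_le1 ?exprn_gt0 ?ltr0n //.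
    by rewrite exprn_ege1 // ler1n.
  by apply/funext => n; rewrite mulrC.
suff -> : 17%:R / 36%:R * zeta 4 = limn (series (fun n => G n / n%:R ^+ 2)) by [].
have c1 := cvg_even _ _ (cvg_series1 _ _ _ cG).
have c2 := cvg_even _ _ (cvg_series1 _ _ _ series_harmonic2_central).
have hb k : `|(-1) ^+ k.-1 * H k| <= 2%:R.
  rewrite normrM -[leRHS]mul1r ler_pM //; [exact: sign_le1 | exact: harmonic2_norm].
have c3 := cvg_even _ _ (cvg_alternating_error _ _ hb).
have c4 := cvgnB _ _ _ _ (cvgnB _ _ _ _ (cvgnZ 2%:R _ _ (c1 _)) (cvgnZ (3%:R / 2%:R) _ _ (c2 _))) c3.
have := cvg_eq_lim _ _ _ _ (cvg_eta 4 isT) (c4 _ _) (fun=> eta4_partial _).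
rewrite central_term0 !(mul0r, mulr0) => /(_ erefl erefl).
have -> : 1 - 2%:R / 2%:R ^+ 4 = 7%:R / 8%:R :> R by field.
rewrite euler_zeta4; move: (limn _) (zeta 4) => L Z e; lra.
Qed.
End CentralBinomialSeries.

(** * Moebius inversion and Ramanujan sums *)

Section Divisors.
Context (V : nmodType).

Lemma sum_divisors_rev (F : nat -> nat -> V) n : (0 < n)%N ->
  \sum_(d <- divisors n) F d (n %/ d)%N = \sum_(d <- divisors n) F (n %/ d)%N d.
Proof.
move=> n0; rewrite (@sum_divisors _ F _ n.+1) //.
rewrite (@sum_divisors _ (fun a b => F b a) _ n.+1) // (exchange_big_dep xpredT) //=.
by apply: eq_bigr => a _; apply: eq_bigl => b; rewrite mulnC.
Qed.

(** Associativity of Dirichlet convolution: both sides run over the triples with [x y b = n]. *)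
Lemma sum_divisors_assoc (F : nat -> nat -> nat -> V) n : (0 < n)%N ->
  \sum_(d <- divisors n) \sum_(x <- divisors d) F x (d %/ x)%N (n %/ d)%N =
  \sum_(x <- divisors n) \sum_(y <- divisors (n %/ x)) F x y (n %/ x %/ y)%N.
Proof.
move=> n0; set M := n.+1.
have sumE m (E : nat -> nat -> V) : (0 < m)%N -> (m < M)%N ->
    \sum_(d <- divisors m) E d (m %/ d)%N =
    \sum_(0 <= a < M) \sum_(0 <= b < M) if (a * b == m)%N then E a b else 0.
  move=> m0 mM; rewrite (@sum_divisors _ E _ M) //.
  by apply: eq_bigr => a _; rewrite big_mkcond.
(* Eliminates an intermediate product [a], which is forced to equal [t]. *)
have pick (c : nat -> bool) t z : (c t -> (t < M)%N) ->
    \sum_(0 <= a < M) (if c a then if t == a then z else 0 else 0) =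
    (if c t then z else 0) :> V.
  move=> ct; transitivity (\sum_(0 <= a < M | a == t) if c t then z else 0).
    rewrite [RHS]big_mkcond; apply: eq_bigr => a _; rewrite eq_sym.
    by case: eqP => [->|] //; case: ifP.
  by rewrite big_nat1_eq /=; case: ifP => //; case: ifP => // /ct ->.
transitivity (\sum_(0 <= x < M) \sum_(0 <= y < M) \sum_(0 <= b < M)
    if (x * y * b == n)%N then F x y b else 0).
  rewrite (sumE n (fun a b => \sum_(x <- divisors a) F x (a %/ x)%N b)) //.
  transitivity (\sum_(0 <= a < M) \sum_(0 <= b < M) \sum_(0 <= x < M) \sum_(0 <= y < M)
      if (a * b == n)%N then if (x * y == a)%N then F x y b else 0 else 0).
    apply: eq_big_nat => a aM; apply: eq_bigr => b _; case: eqP => e.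
      by rewrite (sumE a (fun x y => F x y b)) //; case: (a) e aM => //; lia.
    by rewrite big1 // => x _; rewrite big1.
  rewrite exchange_big /=; under eq_bigr do rewrite exchange_big /=.
  rewrite exchange_big /=; apply: eq_bigr => x _.
  under eq_bigr do rewrite exchange_big /=.
  rewrite exchange_big /=; apply: eq_bigr => y _; apply: eq_bigr => b _.
  apply: (pick (fun a => a * b == n)%N) => /eqP e.
  by rewrite ltnS -e leq_pmulr //; case: b e => //; lia.
rewrite (sumE n (fun x z => \sum_(y <- divisors z) F x y (z %/ y)%N)) //.
apply: eq_bigr => x _.
transitivity (\sum_(0 <= z < M) \sum_(0 <= y < M) \sum_(0 <= b < M)
    if (x * z == n)%N then if (y * b == z)%N then F x y b else 0 else 0); last first.
  apply: eq_big_nat => z zM; case: eqP => e.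
    by rewrite (sumE z (fun y b => F x y b)) //; case: (z) e zM => //; lia.
  by rewrite big1 // => y _; rewrite big1.
rewrite [RHS]exchange_big /=; apply: eq_bigr => y _.
rewrite [RHS]exchange_big /=; apply: eq_bigr => b _.
rewrite (pick (fun z => x * z == n)%N) ?mulnA // => /eqP e.
by rewrite ltnS -e -mulnA leq_pmull //; case: x e => //; lia.
Qed.

End Divisors.

(** * Moebius function and inversion *)

Definition moebius n : int :=
  \prod_(p <- primes n) (if logn p n == 1%N then -1 else 0).

Lemma moebius_norm n : `|moebius n| <= 1.
Proof.
rewrite /moebius; elim/big_rec: _ => [|p x _ hx]; first by rewrite normr1.
by rewrite normrM; case: ifP => _; rewrite ?normrN ?normr1 ?normr0 ?mul1r ?mul0r.
Qed.

Lemma moebius_prime_mul p d : prime p -> (0 < d)%N -> ~~ (p %| d)%N ->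
  moebius (p * d) = - moebius d.
Proof.
move=> pp d0 pd; have p0 := prime_gt0 pp.
have pin : p \notin primes d by rewrite mem_primes pp d0.
rewrite /moebius (perm_big (p :: primes d)); last first.
  apply: uniq_perm => [||q]; rewrite ?primes_uniq //= ?pin ?primes_uniq //.
  by rewrite primesM // primes_prime // inE.
rewrite big_cons lognM // logn_prime // eqxx (lognE p d) pp d0 (negPf pd) /= mulN1r.
congr (- _); apply: eq_big_seq => q qd; rewrite lognM // logn_prime //.
by have -> : (q == p) = false by apply/negbTE; apply: contra pin => /eqP <-.
Qed.

Lemma moebius_sqr_mul p d : prime p -> (0 < d)%N -> (p ^ 2 %| d)%N -> moebius d = 0.
Proof.
move=> pp d0 pd; rewrite /moebius (big_rem p) /=; last first.
  by rewrite mem_primes pp d0 (dvdn_trans _ pd) // dvdn_mulr.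
by move: pd; rewrite pfactor_dvdn //; case: eqP => [->|_ _] //; rewrite mul0r.
Qed.

(** For a prime [p] dividing [n], divisors divisible by [p ^ 2] contribute zero, and the others
    cancel in pairs [d], [p * d] with [d] prime to [p]. *)
Lemma sum_moebius n : (0 < n)%N -> \sum_(d <- divisors n) moebius d = (n == 1)%:R.
Proof.
move=> n0; case: (eqVneq n 1%N) => [->|n1].
  by rewrite big_seq1 /moebius big_nil.
have n2 : (1 < n)%N by lia.
set p := pdiv n; have pp : prime p := pdiv_prime n2.
have pn : (p %| n)%N := pdiv_dvd n.
rewrite (bigID (dvdn p)) /= addrC.
rewrite [X in _ + X](bigID (fun d => p ^ 2 %| d)%N) /= [X in _ + (X + _)]big1_seq ?add0r.
  (* The divisors divisible by [p] but not by [p ^ 2] are the [p * d] with [d] a divisor prime to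
     [p]. *)
  rewrite -[X in _ + X]big_filter [X in _ + X](perm_big
      [seq (p * d)%N | d <- divisors n & ~~ (p %| d)%N]).
    rewrite big_map big_filter -big_split big_seq_cond big1 // => d /andP[].
    rewrite -dvdn_divisors // => dn pd /=.
    by rewrite moebius_prime_mul ?subrr // (dvdn_gt0 n0).
  apply: uniq_perm.
  - by rewrite filter_uniq // divisors_uniq.
  - rewrite map_inj_uniq ?filter_uniq ?divisors_uniq // => x y /eqP.
    by rewrite eqn_pmul2l ?prime_gt0 // => /eqP.
  move=> d; rewrite mem_filter -dvdn_divisors //; apply/idP/mapP.
    move=> /andP[/andP[/dvdnP[x ->]]]; rewrite -mulnn dvdn_pmul2r ?prime_gt0 // => px xn.
    exists x; last by rewrite mulnC.
    by rewrite mem_filter px -dvdn_divisors //; apply: dvdn_trans xn; rewrite dvdn_mulr.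
  move=> [x]; rewrite mem_filter -dvdn_divisors // => /andP[px xn] ->.
  rewrite dvdn_mulr // -mulnn dvdn_pmul2l ?prime_gt0 // px /=.
  by rewrite Gauss_dvd ?pn // prime_coprime.
move=> d /andP[/andP[_ pd]]; rewrite -dvdn_divisors // => dn.
by apply: moebius_sqr_mul pd; rewrite ?(dvdn_gt0 n0).
Qed.

(** After expanding [e] and exchanging sums, the coefficient of [c x] is the Moebius sum over the
    divisors of [n / x], nonzero only for [x = n]. *)
Lemma sum_divisors_moebius_inversion (V : nzRingType) (c e : nat -> V) n :
  (forall k, (0 < k)%N -> \sum_(d <- divisors k) c d = e k) -> (0 < n)%N ->
  c n = \sum_(d <- divisors n) (moebius (n %/ d))%:~R * e d.
Proof.
move=> ce n0.
transitivity (\sum_(d <- divisors n) \sum_(x <- divisors d) (moebius (n %/ d))%:~R * c x);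
  last first.
  rewrite [LHS]big_seq [RHS]big_seq; apply: eq_bigr => d.
  by rewrite -dvdn_divisors // => dn; rewrite -mulr_sumr ce // (dvdn_gt0 n0).
rewrite (sum_divisors_assoc _ (fun x _ b => (moebius b)%:~R * c x)) //.
rewrite (bigD1_seq n) ?divisors_uniq ?divisors_id //= divnn n0 big_seq1 divn1.
rewrite {1}/moebius big_nil mul1r big1_seq ?addr0 // => x /andP[xn].
rewrite -dvdn_divisors // => dx.
have nx0 : (0 < n %/ x)%N by rewrite divn_gt0 ?(dvdn_gt0 n0) // dvdn_leq.
rewrite -mulr_suml -rmorph_sum /=.
rewrite -(sum_divisors_rev _ (fun a b => moebius a)) // sum_moebius //.
have -> : ((n %/ x)%N == 1%N) = false; last by rewrite mul0r.
apply: contraNF xn => /eqP e1.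
by rewrite -[X in _ == X](divnK dx) e1 mul1n.
Qed.

(** Groups the fractions [u / k] by reduced denominator: with [g = gcd(u, k)], [u = g v] and
    [k = g d], where [v] is prime to [d], and [phi] is invariant under scaling by [g]. *)
Lemma sum_divisors_coprime (V : nmodType) (phi : nat -> nat -> V) k : (0 < k)%N ->
  (forall g u d, (0 < g)%N -> (0 < d)%N -> phi (g * u)%N (g * d)%N = phi u d) ->
  \sum_(d <- divisors k) \sum_(1 <= v < d.+1 | coprime v d) phi v d =
  \sum_(1 <= u < k.+1) phi u k.
Proof.
move=> k0 phiM.
rewrite (sum_divisors_rev _ (fun d _ => \sum_(1 <= v < d.+1 | coprime v d) phi v d)) //.
transitivity (\sum_(g <- divisors k) \sum_(1 <= u < k.+1 | gcdn u k == g) phi u k); last first.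
  rewrite (exchange_big_dep xpredT) //=; apply: eq_bigr => u _.
  rewrite (eq_bigl (pred1 (gcdn u k))); last by move=> g; rewrite /= eq_sym.
  rewrite -big_filter (_ : [seq _ <- _ | _] = [:: gcdn u k]) ?big_seq1 //.
  apply: filter_pred1_uniq; first exact: divisors_uniq.
  by rewrite -dvdn_divisors // dvdn_gcdr.
rewrite [LHS]big_seq [RHS]big_seq; apply: eq_bigr => g.
rewrite -dvdn_divisors // => /dvdnP[d kE].
have [g0 d0] : (0 < g)%N /\ (0 < d)%N by nia.
rewrite kE mulnK // mulnC -[RHS]big_filter.
rewrite [RHS](perm_big [seq (g * v)%N | v <- index_iota 1 d.+1 & coprime v d]).
  by rewrite big_map big_filter; apply: eq_bigr => v _; rewrite phiM.
apply: uniq_perm.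
- by rewrite filter_uniq // iota_uniq.
- rewrite map_inj_uniq ?filter_uniq ?iota_uniq // => x y /eqP.
  by rewrite eqn_pmul2l // => /eqP.
move=> u; rewrite mem_filter mem_index_iota; apply/idP/mapP.
  move=> /andP[/eqP ug ukd].
  have /dvdnP[v uE] : (g %| u)%N by rewrite -ug dvdn_gcdl.
  exists v; last by rewrite mulnC.
  rewrite mem_filter mem_index_iota /coprime; apply/andP; split; last by nia.
  by rewrite -(eqn_pmul2l g0) muln1 muln_gcdr (mulnC g v) -uE ug.
move=> [v]; rewrite mem_filter mem_index_iota => /andP[/eqP vd vb] ->.
rewrite -muln_gcdr vd muln1 eqxx /=; nia.
Qed.

(** * Ramanujan sums as bounded real coefficients *)

Section Ramanujan.
Local Open Scope complex_scope.
Context (R : realType).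

Definition cis (x : R) : R[i] := cos x +i* sin x.

Lemma cisD x y : cis (x + y) = cis x * cis y.
Proof. by rewrite /cis cosD sinD; simpc; rewrite [sin x * cos y + _]addrC. Qed.

Lemma cis0 : cis 0 = 1.
Proof. by rewrite /cis cos0 sin0. Qed.

Lemma cisMn x n : cis (x *+ n) = cis x ^+ n.
Proof.
elim: n => [|n IH]; first by rewrite mulr0n cis0.
by rewrite mulrS cisD IH exprS.
Qed.

Lemma cis_2pi : cis (- (2%:R * pi)) = 1.
Proof.
by rewrite /cis cosN sinN mulr_natl cos2pi sin2pi oppr0.
Qed.

(** The real part is [1 - 2 sin(x)^2], and the sine is positive on this interval. *)
Lemma cis_neq1 x : 0 < x < pi -> cis (- (2%:R * x)) != 1.
Proof.
move=> x0; apply/eqP => /(congr1 (@complex.Re R)) /=.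
rewrite cosN mulr_natl cos_mulr2n => h.
have := cos2Dsin2 x; have := sin_gt0_pi x0; nra.
Qed.

Lemma cexp_cis (u N k : nat) :
  cexp (- 'i%C * 2%:R * pi%:C%C * u%:R * N%:R / k%:R) =
  cis (- (2%:R * pi * (u * N)%:R / k%:R)).
Proof.
set x := - (2%:R * pi * (u * N)%:R / k%:R).
have -> : - 'i%C * 2%:R * pi%:C%C * u%:R * N%:R / k%:R = 0 +i* x :> R[i].
  transitivity ('i%C * x%:C).
    rewrite /x rmorphN rmorphM rmorphM fmorphV !rmorphM !rmorph_nat; ring.
  by simpc.
by rewrite /cexp /= expR0 mul1r.
Qed.

(** By [sum_divisors_coprime] this is the sum of [w ^ u] over [1 <= u <= k], where
    [w = exp(-2 pi i N / k)]: a geometric sum with [w ^ k = 1], where [w = 1] exactly if [k] divides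
    [N]. *)
Lemma sum_ramanujan k N : (0 < k)%N ->
  \sum_(d <- divisors k) ramanujan_sum R d N = if (k %| N)%N then k%:R else 0.
Proof.
move=> k0; rewrite /ramanujan_sum.
pose phi u d := cis (- (2%:R * pi * (u * N)%:R / d%:R)).
under eq_bigr do under eq_bigr do rewrite cexp_cis -/(phi _ _).
rewrite (sum_divisors_coprime _ phi) //; last first.
  move=> g u d g0 d0; congr cis; rewrite !natrM.
  have : g%:R != 0 :> R by rewrite pnatr_eq0 -lt0n.
  have : d%:R != 0 :> R by rewrite pnatr_eq0 -lt0n.
  by move=> h1 h2; field; rewrite h1 h2.
have kn0 : k%:R != 0 :> R by rewrite pnatr_eq0 -lt0n.
pose w := phi 1%N k.
have phiE u : phi u k = w ^+ u.
  by rewrite /w /phi -cisMn -mulr_natr; congr cis; rewrite !natrM; field.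
have wk : w ^+ k = 1.
  rewrite -phiE /phi natrM.
  have -> : - (2%:R * pi * (k%:R * N%:R) / k%:R) = - (2%:R * pi) *+ N :> R.
    by rewrite -mulr_natr; field.
  by rewrite cisMn cis_2pi expr1n.
under eq_bigr do rewrite phiE.
rewrite big_add1 /=; under eq_bigr do rewrite exprS.
rewrite -mulr_sumr big_mkord; case: ifPn => kN.
  have -> : w = 1.
    rewrite /w /phi mul1n; have /dvdnP[q ->] := kN; rewrite natrM.
    have -> : - (2%:R * pi * (q%:R * k%:R) / k%:R) = - (2%:R * pi) *+ q :> R.
      by rewrite -mulr_natr; field.
    by rewrite cisMn cis_2pi expr1n.
  by under eq_bigr do rewrite expr1n; rewrite sumr_const card_ord mul1r.
(* Reducing [N] to its remainder [r] modulo [k] leaves half the angle, [pi r / k], strictly between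
   [0] and [pi]. *)
have w1 : w != 1.
  rewrite /w /phi mul1n {1}(divn_eq N k) natrD natrM.
  set r := (N %% k)%N.
  have -> : - (2%:R * pi * ((N %/ k)%:R * k%:R + r%:R) / k%:R) =
      - (2%:R * pi) *+ (N %/ k) + - (2%:R * (pi * r%:R / k%:R)) :> R.
    by rewrite -mulr_natr; field.
  rewrite cisD cisMn cis_2pi expr1n mul1r; apply: cis_neq1.
  have k1 : 0 < k%:R :> R by rewrite ltr0n.
  have r0 : 0 < r%:R :> R by rewrite ltr0n lt0n.
  have rk : r%:R < k%:R :> R by rewrite ltr_nat ltn_mod.
  have pi0 := pi_gt0 R.
  by rewrite divr_gt0 ?mulr_gt0 //= ltr_pdivrMr // ltr_pM2l.
have /eqP : (w - 1) * \sum_(i < k) w ^+ i = 0 by rewrite -subrX1 wk subrr.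
by rewrite mulf_eq0 subr_eq0 (negPf w1) /= => /eqP ->; rewrite mulr0.
Qed.

(** The Moebius-inverted form of the Ramanujan sum, with real values so that the analysis stays in
    [R]. *)
Definition ramanujan_real (N k : nat) : R :=
  \sum_(d <- divisors k) (moebius (k %/ d))%:~R * (if (d %| N)%N then d%:R else 0).

Lemma ramanujan_sumE k N : (0 < k)%N -> ramanujan_sum R k N = (ramanujan_real N k)%:C.
Proof.
move=> k0.
rewrite (sum_divisors_moebius_inversion _ (ramanujan_sum R ^~ N) _ _ (sum_ramanujan^~ N)) //.
rewrite /ramanujan_real rmorph_sum; apply: eq_bigr => d _ /=.
by rewrite rmorphM rmorph_int; case: ifP => _; rewrite ?rmorph_nat ?rmorph0.
Qed.

Lemma sum_ramanujan_real k N : (0 < k)%N ->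
  \sum_(d <- divisors k) ramanujan_real N d = if (k %| N)%N then k%:R else 0.
Proof.
move=> k0; have := sum_ramanujan k N k0.
rewrite (eq_big_seq (fun d => (ramanujan_real N d)%:C)); last first.
  by move=> d; rewrite -dvdn_divisors // => dk; rewrite ramanujan_sumE // (dvdn_gt0 k0).
rewrite -rmorph_sum /= => /(congr1 (@complex.Re R)) /= ->.
by case: ifP => // _; rewrite -(rmorph_nat (real_complex R)).
Qed.

(** Only common divisors of [k] and [N] contribute: at most [N.+1] of them, each by at most [N]. The
    bound does not involve [k]. *)
Lemma ramanujan_real_le N k : (0 < N)%N -> `|ramanujan_real N k| <= (N.+1 * N)%:R.
Proof.
move=> N0; apply: le_trans (ler_norm_sum _ _ _) _.
apply: (@le_trans _ _ (\sum_(d <- divisors k | (d %| N)%N) N%:R)).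
  rewrite [leRHS]big_mkcond; apply: ler_sum => d _.
  rewrite normrM; case: ifP => dN; last by rewrite normr0 mulr0.
  rewrite normr_nat -[leRHS]mul1r; apply: ler_pM.
  - exact: normr_ge0.
  - exact: ler0n.
  - by rewrite -intr_norm -[leRHS]/(1%:~R) ler_int moebius_norm.
  by rewrite ler_nat dvdn_leq.
rewrite -big_filter big_const_seq count_predT iter_addr_0 -mulrnA ler_nat mulnC.
rewrite leq_mul2r; apply/orP; right.
rewrite -(size_iota 0 N.+1); apply: uniq_leq_size; first by rewrite filter_uniq ?divisors_uniq.
by move=> d; rewrite mem_filter mem_iota => /andP[/(dvdn_leq N0)]; lia.
Qed.

End Ramanujan.

(** * Ramanujan expansions *)

Section RamanujanExpansion.
Local Open Scope classical_set_scope.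
Context (R : realType).

Lemma real_complex_norm (x : R) : `|x%:C%C| = `|x|%:C%C.
Proof. by rewrite normc_def /= expr0n addr0 sqrtr_sqr. Qed.

Lemma series_real_complex (a : nat -> R[i]) (b : nat -> R) (l : R) :
  b 0 = 0 -> (forall n, (0 < n)%N -> a n = (b n)%:C%C) -> series b @ \oo --> l ->
  series_cvg a /\ series_sum a = l%:C%C.
Proof.
move=> b0 ab bl.
have partialE m : \sum_(1 <= n < m) (a n : R[i]^o) = (series b m)%:C%C.
  case: m => [|m]; first by rewrite /series /= !big_geq.
  rewrite series1 // rmorph_sum; apply: eq_big_nat => n /andP[n0 _]; exact: ab.
have cl : (fun m : nat => \sum_(1 <= n < m) (a n : R[i]^o)) @ \oo --> (l%:C%C : R[i]^o).
  apply/cvgrPdist_lt => e e0.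
  (* A positive element for the order on [R[i]] has zero imaginary part. *)
  have eE : e = (complex.Re e)%:C%C.
    by move: e0; case: (e) => x y; rewrite ltcE /= => /andP[/eqP ->].
  have e1 : 0 < complex.Re e by rewrite eE ltcR in e0.
  have /cvgrPdist_lt /(_ _ e1)[M0 _ h] := bl.
  exists M0 => // m /= M0m; rewrite partialE -rmorphB real_complex_norm eE ltcR.
  exact: h.
split; first by apply/cvg_ex; exists (l%:C%C : R[i]^o).
by apply: (cvg_lim _ cl); exact: norm_hausdorff.
Qed.

(** The series is a finite sum over [n] dividing [N], and [n^(1-s) = (N/n)^(s-1) / N^(s-1)], so
    reversing the divisors gives [sigma]. *)
Lemma series_divisor_pow s N : (2 <= s)%N -> (0 < N)%N ->
  series (fun n => powinv s n * (if (n %| N)%N then n%:R else 0)) @ \oo -->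
  ((sigma s.-1 N)%:R / N%:R ^+ s.-1 : R).
Proof.
move=> s2 N0; set b := fun n => _.
have bE m : (N < m)%N -> series b m = (sigma s.-1 N)%:R / N%:R ^+ s.-1.
  move=> Nm; rewrite /sigma natr_sum mulr_suml.
  rewrite (sum_divisors_rev _ (fun d _ => (d ^ s.-1)%:R / N%:R ^+ s.-1)) //.
  rewrite (sum_divisors_nat _ _ _ m) // big_mkcond /series /=; apply: eq_bigr => d _.
  rewrite /b; case: ifPn => [/dvdnP[q NE]|_]; last by rewrite mulr0.
  have [q0 d0] : (0 < q)%N /\ (0 < d)%N by nia.
  rewrite NE mulnK // natrX natrM /powinv; case: s s2 {b} => // s _.
  rewrite exprS exprMn /=.
  have hq : q%:R != 0 :> R by rewrite pnatr_eq0; lia.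
  have hd : d%:R != 0 :> R by rewrite pnatr_eq0; lia.
  by field; rewrite !expf_neq0.
apply/cvgrPdist_le => e e0; exists N.+1 => // m /= Nm.
by rewrite bE // subrr normr0 ltW.
Qed.

(** The series is the Dirichlet product of [f n / n^s], with sum [kappa * zeta s], and of [c], whose
    sum times [zeta s] is the quotient with [sigma]. *)
Lemma series_divisors_ramanujan (f : nat -> R) (kappa : R) s N :
  (2 <= s)%N -> (0 < N)%N -> (forall n, `|f n| <= 1) ->
  series (fun n => f n * powinv s n) @ \oo --> kappa * zeta s ->
  series (fun n => powinv s n * \sum_(d <- divisors n) f d * ramanujan_real R N (n %/ d))
    @ \oo --> kappa * ((sigma s.-1 N)%:R / N%:R ^+ s.-1).
Proof.
move=> s2 N0 f1 cf.
have p0 : powinv s 0 = 0 :> R by rewrite powinv0 //; lia.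
pose c n := ramanujan_real R N n * powinv s n.
have c0 : c 0 = 0 by rewrite /c p0 mulr0.
pose K : R := (N.+1 * N)%:R.
have cn : cvgn (series (fun n => `|c n|)).
  apply: (@is_cvg_norm_series _ _ K s) => // n.
  by rewrite normrM (ger0_norm (powinv_ge0 _ _)) ler_wpM2r ?powinv_ge0 // ramanujan_real_le.
have cc : series c @ \oo --> limn (series c) by exact: normed_cvg.
have zn : cvgn (series (fun n => `|powinv s n : R|)).
  apply: (@is_cvg_norm_series _ _ 1 s) => // n.
  by rewrite mul1r ger0_norm // powinv_ge0.
have fn : cvgn (series (fun n => `|f n * powinv s n|)).
  apply: (@is_cvg_norm_series _ _ 1 s) => // n.
  by rewrite normrM (ger0_norm (powinv_ge0 _ _)) ler_wpM2r ?powinv_ge0.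
(* Since [d (n / d) = n], the factors [d^(-s)] and [(n/d)^(-s)] combine to [n^(-s)], which leaves
   the divisor sum. *)
have dirE (u v : nat -> R) : (fun n => \sum_(d <- divisors n)
    (u d * powinv s d) * (v (n %/ d)%N * powinv s (n %/ d)%N)) =
    (fun n => powinv s n * \sum_(d <- divisors n) u d * v (n %/ d)%N).
  apply/funext => -[|n]; first by rewrite big_seq1 divn1 p0 !(mulr0, mul0r).
  rewrite mulr_sumr; apply: eq_big_seq => d; rewrite -dvdn_divisors // => dn.
  rewrite /powinv -{3}(divnK dn) natrM exprMn invfM; ring.
(* Convolving the Ramanujan coefficients with [1] gives [n] if [n] divides [N] and [0] otherwise. *)
have CZ : limn (series c) * zeta s = (sigma s.-1 N)%:R / N%:R ^+ s.-1.
  have h := cvg_dirichlet _ _ _ _ c0 p0 cc (cvg_zeta s s2) cn zn.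
  apply: (cvg_eq_lim _ _ _ _ h (series_divisor_pow s N s2 N0)) => M.
  congr (series _ M).
  have := dirE (ramanujan_real R N) (fun=> 1).
  under eq_fun do under eq_bigr do rewrite mul1r.
  move=> ->; apply/funext => -[|n]; first by rewrite p0 !mul0r.
  by under eq_bigr do rewrite mulr1; rewrite sum_ramanujan_real.
have fp0 : f 0 * powinv s 0 = 0 by rewrite p0 mulr0.
have := cvg_dirichlet _ _ _ _ fp0 c0 cf cc fn cn.
by rewrite /c dirE -mulrA [zeta s * _]mulrC CZ.
Qed.

Lemma ramanujan_series (a : nat -> R[i]) (f : nat -> R) (kappa : R) s N :
  (2 <= s)%N -> (0 < N)%N -> (forall n, `|f n| <= 1) ->
  series (fun n => f n * powinv s n) @ \oo --> kappa * zeta s ->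
  (forall n, a n = n%:R ^- s *
     \sum_(d <- divisors n) (f d)%:C%C * ramanujan_sum R (n %/ d) N) ->
  series_cvg a /\
  series_sum a = kappa%:C%C * ((sigma s.-1 N)%:R / N%:R ^+ s.-1).
Proof.
move=> s2 N0 f1 cf aE.
have [|n n0|c ->] := series_real_complex a
  (fun n => powinv s n * \sum_(d <- divisors n) f d * ramanujan_real R N (n %/ d)) _ _ _
  (series_divisors_ramanujan f kappa s N s2 N0 f1 cf).
- by rewrite powinv0 ?mul0r //; lia.
- rewrite aE /powinv rmorphM fmorphV rmorphXn rmorph_nat rmorph_sum; congr (_ * _).
  apply: eq_big_seq => d; rewrite -dvdn_divisors // => dn.
  by rewrite rmorphM ramanujan_sumE // divn_gt0 ?(dvdn_gt0 n0) // dvdn_leq.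
by split => //; rewrite rmorphM rmorphM fmorphV rmorphXn !rmorph_nat.
Qed.

(** * The three central binomial coefficients and the conclusion *)

Lemma inv_bin_le1 n : `|'C(2 * n, n)%:R^-1| <= 1 :> R.
Proof.
by rewrite normfV normr_nat invf_le1 ?ler1n ?ltr0n bin_gt0 leq_pmull.
Qed.

Lemma series_inv_bin2 :
  series (fun n => 'C(2 * n, n)%:R^-1 * powinv 2 n : R) @ \oo --> 3%:R^-1 * (zeta 2 : R).
Proof.
rewrite mulrC (_ : (fun n => _) = @central_term R); first exact: series_central2.
by apply/funext => n; rewrite central_termE.
Qed.

Lemma series_inv_bin3 :
  series (fun n => (-1) ^+ n.-1 * 'C(2 * n, n)%:R^-1 * powinv 3 n : R) @ \oo -->
  (2%:R / 5%:R) * (zeta 3 : R).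
Proof.
rewrite (_ : (fun n => _) = fun n => (-1) ^+ n.-1 * central_term n / n%:R).
  exact: series_central3.
apply/funext => n; rewrite central_termE /powinv !exprS expr0 !invfM invr1; ring.
Qed.

Lemma series_inv_bin4 :
  series (fun n => 'C(2 * n, n)%:R^-1 * powinv 4 n : R) @ \oo -->
  (17%:R / 36%:R) * (zeta 4 : R).
Proof.
rewrite (_ : (fun n => _) = fun n => central_term n / n%:R ^+ 2).
  exact: series_central4.
apply/funext => n; rewrite central_termE /powinv !exprS expr0 !invfM invr1; ring.
Qed.

End RamanujanExpansion.

Theorem theorem1 (R : realType) (N : nat) (hN : (1 <= N)%N) :
  let a1 (n : nat) : R[i] :=
    n%:R ^- 2 * \sum_(d <- divisors n)
      'C(2 * d, d)%:R^-1 * ramanujan_sum R (n %/ d) N in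
  let a2 (n : nat) : R[i] :=
    n%:R ^- 3 * \sum_(d <- divisors n)
      (-1) ^+ d.-1 * 'C(2 * d, d)%:R^-1 * ramanujan_sum R (n %/ d) N in
  let a3 (n : nat) : R[i] :=
    n%:R ^- 4 * \sum_(d <- divisors n)
      'C(2 * d, d)%:R^-1 * ramanujan_sum R (n %/ d) N in
  [/\ series_cvg a1 /\
        (sigma 1 N)%:R / N%:R = 3%:R * series_sum a1,
      series_cvg a2 /\
        (sigma 2 N)%:R / N%:R ^+ 2 = 5%:R / 2%:R * series_sum a2
    & series_cvg a3 /\
        (sigma 3 N)%:R / N%:R ^+ 3 = 36%:R / 17%:R * series_sum a3].
Proof.
move=> a1 a2 a3.
pose f (d : nat) : R := 'C(2 * d, d)%:R^-1.
pose g (d : nat) : R := (-1) ^+ d.-1 * f d.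
have f1 : forall d, `|f d| <= 1 by exact: inv_bin_le1.
have g1 d : `|g d| <= 1.
  by rewrite -[leRHS]mul1r normrM ler_pM // sign_le1.
have fC d : (f d)%:C%C = 'C(2 * d, d)%:R^-1 :> R[i].
  by rewrite /f fmorphV rmorph_nat.
(* The constant [kappa] is read off from the central binomial series: [1/3] here, then [2/5] and
   [17/36]. The tactic term moves the coefficients of the summand into the image of [R] in
   [R[i]]. *)
have [s1 e1] := ramanujan_series R a1 f _ 2 N isT hN f1 (series_inv_bin2 R)
  (fun n => ltac:(by rewrite /a1; under eq_bigr do rewrite -fC)).
have [s2 e2] := ramanujan_series R a2 g _ 3 N isT hN g1 (series_inv_bin3 R)
  (fun n => ltac:(by rewrite /a2; under eq_bigr do
     rewrite -fC -(rmorph_sign (real_complex R)) -rmorphM)).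
have [s3 e3] := ramanujan_series R a3 f _ 4 N isT hN f1 (series_inv_bin4 R)
  (fun n => ltac:(by rewrite /a3; under eq_bigr do rewrite -fC)).
split; split => //.
- by rewrite e1 fmorphV rmorph_nat mulVKf ?pnatr_eq0.
- rewrite e2 fmorph_div !rmorph_nat mulrA.
  by rewrite (_ : 5%:R / 2%:R * (2%:R / 5%:R) = 1) ?mul1r //; field.
- rewrite e3 fmorph_div !rmorph_nat mulrA.
  by rewrite (_ : 36%:R / 17%:R * (17%:R / 36%:R) = 1) ?mul1r //; field.
Qed.
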